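(* Let $\mathbf{F}$ be an arbitrary field, let $(T,[\cdot,\cdot,\cdot],\alpha)$ be a multiplicative Hom-Lie triple system over $\mathbf{F}$, let $V$ be an $\mathbf{F}$-vector space, $A\in \mathrm{End}(V)$, and let $\theta$ be a representation of $(T,[\cdot,\cdot,\cdot],\alpha)$ on $V$ with respect to $A$. Then for every $n\ge 1$ the coboundary operators $\delta^n_{hom}:C^n_{\alpha,A}(T,V)\to C^{n+2}_{\alpha,A}(T,V)$ satisfy $\delta^{n+2}_{hom}\,\delta^n_{hom}=0$.
   Context: **Multiplicative Hom-Lie triple system (Hom-LTS).** A triple $(T,[\cdot,\cdot,\cdot],\alpha)$ with $T$ an $\mathbf{F}$-vector space, a trilinear map $T\times T\times T\to T$, $(x,y,z)\mapsto[xyz]$, and a linear map $\alpha:T\to T$ such that for all $x,y,z,u,v\in T$: (1) $[xxz]=0$; (2) $[xyz]+[yzx]+[zxy]=0$; (3) $[\alpha(u)\alpha(v)[xyz]]=[[uvx]\alpha(y)\alpha(z)]+[\alpha(x)[uvy]\alpha(z)]+[\alpha(x)\alpha(y)[uvz]]$; (4) $\alpha([xyz])=[\alpha(x)\alpha(y)\alpha(z)]$. **Representation.** A representation of $(T,[\cdot,\cdot,\cdot],\alpha)$ on a vector space $V$ with respect to $A\in\mathrm{End}(V)$ is a bilinear map $\theta:T\times T\to \mathrm{End}(V)$ such that, with $D(a,b):=\theta(b,a)-\theta(a,b)$, for all $a,b,c,d\in T$: - $\theta(\alpha(a),\alpha(b))\circ A=A\circ\theta(a,b)$; - $\theta(\alpha(c),\alpha(d))\theta(a,b)-\theta(\alpha(b),\alpha(d))\theta(a,c)-\theta(\alpha(a),[bcd])\circ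 A+D(\alpha(b),\alpha(c))\theta(a,d)=0$; - $\theta(\alpha(c),\alpha(d))D(a,b)-D(\alpha(a),\alpha(b))\theta(c,d)+\theta([abc],\alpha(d))\circ A+\theta(\alpha(c),[abd])\circ A=0$. **Cochains.** For $n\ge1$, $C^n_{\alpha,A}(T,V)$ is the space of $n$-linear maps $f:T^n\to V$ (called $n$-Hom-cochains) such that - $A(f(x_1,\dots,x_n))=f(\alpha(x_1),\dots,\alpha(x_n))$; - (for $n\ge3$) $f(x_1,\dots,x_{n-3},x,x,x_n)=0$; - (for $n\ge 3$) $f(x_1,\dots,x_{n-3},x,y,z)+f(x_1,\dots,x_{n-3},y,z,x)+f(x_1,\dots,x_{n-3},z,x,y)=0$. **Coboundary operator.** $\delta^n_{hom}:C^n_{\alpha,A}(T,V)\to C^{n+2}_{\alpha,A}(T,V)$ is defined as follows (a hat means omission; in the last sums, $[x_{2k-1}x_{2k}x_j]$ stands in the place of $x_j$, and every other remaining argument $x_i$ is replaced by $\alpha(x_i)$). For $f\in C^{2n-1}_{\alpha,A}(T,V)$, $n\ge1$: $$\begin{aligned}\delta^{2n-1}_{hom}f(x_1,\dots,x_{2n+1})=\;&\theta(\alpha^{n-1}(x_{2n}),\alpha^{n-1}(x_{2n+1}))f(x_1,\dots,x_{2n-1})\\&-\theta(\alpha^{n-1}(x_{2n-1}),\alpha^{n-1}(x_{2n+1}))f(x_1,\dots,x_{2n-2},x_{2n})\\&+\sum_{k=1}^n(-1)^{n+k}D(\alpha^{n-1}(x_{2k-1}),\alpha^{n-1}(x_{2k}))f(x_1,\dots,\widehat{x_{2k-1}},\widehat{x_{2k}},\dots,x_{2n+1})\\&+\sum_{k=1}^n\sum_{j=2k+1}^{2n+1}(-1)^{n+k+1}f(\alpha(x_1),\dots,\widehat{x_{2k-1}},\widehat{x_{2k}},\dots,[x_{2k-1}x_{2k}x_j],\dots,\alpha(x_{2n+1})).\end{aligned}$$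 For $f\in C^{2n}_{\alpha,A}(T,V)$, $n\ge1$: $$\begin{aligned}\delta^{2n}_{hom}f(y,x_1,\dots,x_{2n+1})=\;&\theta(\alpha^{n}(x_{2n}),\alpha^{n}(x_{2n+1}))f(y,x_1,\dots,x_{2n-1})\\&-\theta(\alpha^{n}(x_{2n-1}),\alpha^{n}(x_{2n+1}))f(y,x_1,\dots,x_{2n-2},x_{2n})\\&+\sum_{k=1}^n(-1)^{n+k}D(\alpha^{n}(x_{2k-1}),\alpha^{n}(x_{2k}))f(y,x_1,\dots,\widehat{x_{2k-1}},\widehat{x_{2k}},\dots,x_{2n+1})\\&+\sum_{k=1}^n\sum_{j=2k+1}^{2n+1}(-1)^{n+k+1}f(\alpha(y),\alpha(x_1),\dots,\widehat{x_{2k-1}},\widehat{x_{2k}},\dots,[x_{2k-1}x_{2k}x_j],\dots,\alpha(x_{2n+1})).\end{aligned}$$ *)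

(* Defs.v *)
From HB Require Import structures.
From mathcomp Require Import all_boot all_order all_algebra.

Set Implicit Arguments.
Unset Strict Implicit.
Unset Printing Implicit Defensive.

Import GRing.Theory.
Local Open Scope ring_scope.

Record hom_LTS (F : fieldType) (T : lmodType F)
    (br : T -> T -> T -> T) (alpha : {linear T -> T}) : Prop := HomLTS {
  br_linear1 : forall y z, linear (fun x => br x y z);
  br_linear2 : forall x z, linear (fun y => br x y z);
  br_linear3 : forall x y, linear (fun z => br x y z);
  br_alt : forall x z, br x x z = 0;
  br_cyclic : forall x y z, br x y z + br y z x + br z x y = 0;
  br_hom_derivation : forall u v x y z,
    br (alpha u) (alpha v) (br x y z)
    = br (br u v x) (alpha y) (alpha z) + br (alpha x) (br u v y) (alpha z)
      + br (alpha x) (alpha y) (br u v z);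
  br_multiplicative : forall x y z,
    alpha (br x y z) = br (alpha x) (alpha y) (alpha z)
}.

Definition repD (F : fieldType) (T V : lmodType F)
    (theta : T -> T -> {linear V -> V}) (a b : T) (v : V) : V :=
  theta b a v - theta a b v.

Record hom_LTS_rep (F : fieldType) (T V : lmodType F)
    (br : T -> T -> T -> T) (alpha : {linear T -> T})
    (A : {linear V -> V}) (theta : T -> T -> {linear V -> V}) : Prop :=
  HomLTSRep {
  rep_linear1 : forall b v, linear (fun a => theta a b v);
  rep_linear2 : forall a v, linear (fun b => theta a b v);
  rep_equivariant : forall a b v,
    theta (alpha a) (alpha b) (A v) = A (theta a b v);
  rep_theta_theta : forall a b c d v,
    theta (alpha c) (alpha d) (theta a b v)
    - theta (alpha b) (alpha d) (theta a c v)
    - theta (alpha a) (br b c d) (A v)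
    + repD theta (alpha b) (alpha c) (theta a d v) = 0;
  rep_theta_D : forall a b c d v,
    theta (alpha c) (alpha d) (repD theta a b v)
    - repD theta (alpha a) (alpha b) (theta c d v)
    + theta (br a b c) (alpha d) (A v)
    + theta (alpha c) (br a b d) (A v) = 0
}.

(* Maps T^m -> V are functions on {ffun 'I_m -> T}; [app_seq f [:: t1; ..; tm]]
   is f (t1, .., tm).  It is meant for lists of length exactly m only, so the
   default value 0 of [nth] is never reached. *)
Definition app_seq (F : fieldType) (T V : lmodType F) (m : nat)
    (f : {ffun 'I_m -> T} -> V) (s : seq T) : V :=
  f [ffun i : 'I_m => nth 0 s i].

(* In the last two fields s stands for (x_1, .., x_(m-3)); the length condition
   forces m >= 3, so they are void for m < 3. *)
Record hom_cochain (F : fieldType) (T V : lmodType F)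
    (alpha : {linear T -> T}) (A : {linear V -> V}) (m : nat)
    (f : {ffun 'I_m -> T} -> V) : Prop := HomCochain {
  cochain_multilinear : forall (x : {ffun 'I_m -> T}) (i : 'I_m),
    linear (fun u => f [ffun j => if j == i then u else x j]);
  cochain_equivariant : forall x : {ffun 'I_m -> T},
    A (f x) = f [ffun i => alpha (x i)];
  cochain_alt : forall (s : seq T) (x z : T), (size s).+3 = m ->
    app_seq f (s ++ [:: x; x; z]) = 0;
  cochain_cyclic : forall (s : seq T) (x y z : T), (size s).+3 = m ->
    app_seq f (s ++ [:: x; y; z]) + app_seq f (s ++ [:: y; z; x])
    + app_seq f (s ++ [:: z; x; y]) = 0
}.

Section Coboundary.

Variables (F : fieldType) (T V : lmodType F).
Variables (br : T -> T -> T -> T) (alpha : {linear T -> T}).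
Variable theta : T -> T -> {linear V -> V}.

(* The indices 1, .., 2n+1 with 2k-1 and 2k omitted. *)
Definition hat_indices (n k : nat) : seq nat :=
  [seq i <- iota 1 n.*2.+1 | i \notin [:: k.*2.-1; k.*2]].

(* Arguments x_1, .., x_(2n+1) are the values x 1, .., x (2n+1), for n >= 1;
   here m = 2n-1. *)
Definition coboundary_odd (n m : nat) (f : {ffun 'I_m -> T} -> V)
    (x : nat -> T) : V :=
  let a i := iter n.-1 alpha (x i) in
    theta (a n.*2) (a n.*2.+1)
      (app_seq f [seq x i | i <- iota 1 n.*2.-1])
  - theta (a n.*2.-1) (a n.*2.+1)
      (app_seq f [seq x i | i <- rcons (iota 1 n.*2.-2) n.*2])
  + \sum_(1 <= k < n.+1) (-1) ^+ (n + k) *: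
      repD theta (a k.*2.-1) (a k.*2)
        (app_seq f [seq x i | i <- hat_indices n k])
  + \sum_(1 <= k < n.+1) \sum_(k.*2.+1 <= j < n.*2.+2) (-1) ^+ (n + k + 1) *:
      app_seq f [seq (if i == j then br (x k.*2.-1) (x k.*2) (x j)
                      else alpha (x i)) | i <- hat_indices n k].

(* Same conventions, with m = 2n and the extra first argument y. *)
Definition coboundary_even (n m : nat) (f : {ffun 'I_m -> T} -> V)
    (y : T) (x : nat -> T) : V :=
  let a i := iter n alpha (x i) in
    theta (a n.*2) (a n.*2.+1)
      (app_seq f (y :: [seq x i | i <- iota 1 n.*2.-1]))
  - theta (a n.*2.-1) (a n.*2.+1)
      (app_seq f (y :: [seq x i | i <- rcons (iota 1 n.*2.-2) n.*2]))
  + \sum_(1 <= k < n.+1) (-1) ^+ (n + k) *: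
      repD theta (a k.*2.-1) (a k.*2)
        (app_seq f (y :: [seq x i | i <- hat_indices n k]))
  + \sum_(1 <= k < n.+1) \sum_(k.*2.+1 <= j < n.*2.+2) (-1) ^+ (n + k + 1) *:
      app_seq f (alpha y ::
        [seq (if i == j then br (x k.*2.-1) (x k.*2) (x j)
              else alpha (x i)) | i <- hat_indices n k]).

(* [arg] numbers the arguments from 0.  For odd m they are x_1, .., x_(m+2), so
   x_i is [arg i.-1]; for even m they are y, x_1, .., x_(m+1), so y is [arg 0]
   and x_i is [arg i].  Only m >= 1 is meaningful. *)
Definition coboundary (m : nat) (f : {ffun 'I_m -> T} -> V) :
    {ffun 'I_m.+2 -> T} -> V :=
  fun z =>
    let arg i := nth 0 (fgraph z) i in
    if odd m then coboundary_odd m.+1./2 f (fun i => arg i.-1)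
    else coboundary_even m./2 f (arg 0%N) arg.

End Coboundary.

(* Main.v *)
Require Import Defs.
From mathcomp Require Import all_boot all_order all_algebra.

Set Implicit Arguments.
Unset Strict Implicit.
Unset Printing Implicit Defensive.

Import GRing.Theory.
Local Open Scope ring_scope.

(* Write an odd number of arguments as pairs X_1, .., X_n followed by z.  Let
   i_X insert the pair X = (x, y) in front of the arguments, let L_X be the action
   of D(x, y) minus the derivation [x y -] applied to the arguments, and let t_X f
   be z |-> theta(y, z) f(x) - theta(x, z) f(y).  Up to a sign the coboundary d
   is determined by Cartan's formula

     i_X d = L_X - d i_X      (plus t_X when a single argument remains).

   The derivation property of the bracket and the axiom relating theta and D
   give [L_X, L_Y] = L_[X,Y], hence L_X d = d L_X by induction on the number of
   arguments.  Then i_X d d = d d i_X - d t_X, where d t_X = 0 is the axiom on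
   theta theta, and d d = 0 by induction.

   The twist is handled by carrying a sequence f_0, f_1, f_2 with
   A f_i(x) = f_(i+1)(alpha x) instead of a single cochain: this class is stable
   under insertion if the inserted arguments of f_(i+1) are the images under
   alpha of those of f_i.  Since the exponent p of alpha in theta and D is
   arbitrary, cochains of even degree are the odd case with y inserted. *)

(** * Normalization in additive groups *)

Ltac zmod_step :=
  match goal with
  | |- 0 + _ = _ => rewrite add0r
  | |- - ?x + _ = _ =>
    let rec go := first [rewrite (addKr x) | rewrite [_ + (x + _)]addrCA; go] in
    go
  | |- ?x + _ = _ =>
    let rec go :=
      first [rewrite (addNKr x) | rewrite [_ + (- x + _)]addrCA; go] in
    go
  end.

(* The normalization matches syntactically, so that defined sums such as [repD]
   stay folded. *)
Ltac zmod :=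
  apply/eqP; rewrite -subr_eq0; apply/eqP;
  repeat match goal with
  | |- context [_ *: (?x + ?y)] => rewrite (scalerDr _ x y)
  | |- context [_ *: (- ?x)] => rewrite (scalerN _ x)
  | |- context [- (?x + ?y)] => rewrite (opprD x y)
  | |- context [- - ?x] => rewrite (opprK x)
  end;
  (* The trailing 0 makes every summand the head of a sum, so the cancellation patterns also match
     the last one. *)
  rewrite ?scaler0 ?oppr0 -[LHS]addr0;
  repeat match goal with
  | |- context [?x + ?y + ?z] => rewrite -(addrA x y z)
  end;
  repeat zmod_step; reflexivity.

(** * Additivity of bare functions satisfying the predicate [linear] *)

Section Linear.

Variables (R : pzRingType) (U W : lmodType R) (f : U -> W).
Hypothesis f_lin : linear f.

Lemma linear_morphD : {morph f : u v / u + v}.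
Proof. by move=> u v; rewrite -[u]scale1r f_lin !scale1r. Qed.

Lemma linear_map0 : f 0 = 0.
Proof. by apply: (addrI (f 0)); rewrite -linear_morphD !addr0. Qed.

Lemma linear_morphN : {morph f : u / - u}.
Proof.
by move=> u; apply: (addrI (f u)); rewrite -linear_morphD !subrr linear_map0.
Qed.

End Linear.

(** Cartan's formula strips arguments two at a time, which calls for this induction. *)
Lemma pair_ind (X : Type) (P : seq X -> Prop) :
  P [::] -> (forall a, P [:: a]) ->
  (forall a b s, P s -> P (a :: b :: s)) -> forall s, P s.
Proof.
move=> P0 P1 PS s.
suff [] : P s /\ forall a, P (a :: s) by [].
by elim: s => [|b s [IH1 IH2]]; split=> // a; apply: PS.
Qed.

(** * Cartan calculus on functions of lists *)

Section ListCochains.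

Variables (F : fieldType) (T V : lmodType F).
Variables (br : T -> T -> T -> T) (alpha : {linear T -> T}).
Variables (A : {linear V -> V}) (theta : T -> T -> {linear V -> V}).
Hypotheses (hT : hom_LTS br alpha) (hV : hom_LTS_rep br alpha A theta).

Local Notation D := (repD theta).
Local Notation "x ^[ p ]" := (iter p alpha x) (at level 2, format "x ^[ p ]").

Implicit Types (a b c x y z : T) (s t : seq T) (g h : seq T -> V).

Lemma iter_alpha_linear p : linear (iter p alpha).
Proof. by elim: p => [|p IH] c a b //=; rewrite IH linearP. Qed.

Lemma iter_alpha_br p x y z : (br x y z)^[p] = br x^[p] y^[p] z^[p].
Proof. by elim: p => //= p ->; rewrite (br_multiplicative hT). Qed.

Lemma theta_linear1 k a a' b v :
  theta (k *: a + a') b v = k *: theta a b v + theta a' b v.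
Proof. exact: (rep_linear1 hV). Qed.

Lemma theta_linear2 k a b b' v :
  theta a (k *: b + b') v = k *: theta a b v + theta a b' v.
Proof. exact: (rep_linear2 hV). Qed.

Lemma theta_linear3 a b k u v :
  theta a b (k *: u + v) = k *: theta a b u + theta a b v.
Proof. exact: linearP. Qed.

Lemma repD_linear a b : linear (D a b).
Proof.
move=> k u v; rewrite /repD !theta_linear3; zmod.
Qed.

Lemma repDB a b u v : D a b (u - v) = D a b u - D a b v.
Proof.
rewrite (linear_morphD (@repD_linear a b)).
by rewrite (linear_morphN (@repD_linear a b)).
Qed.

Lemma repD_linear1 b v : linear (fun a => D a b v).
Proof.
move=> k a a'; rewrite /repD theta_linear1 theta_linear2; zmod.
Qed.

Lemma repD_linear2 a v : linear (fun b => D a b v).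
Proof.
move=> k b b'; rewrite /repD theta_linear1 theta_linear2; zmod.
Qed.

Lemma A_repD a b v : A (D a b v) = D (alpha a) (alpha b) (A v).
Proof. by rewrite /repD linearB !(rep_equivariant hV). Qed.

Lemma repD_theta a b c d v :
  D (alpha a) (alpha b) (theta c d v)
  = theta (alpha c) (alpha d) (D a b v) + theta (br a b c) (alpha d) (A v)
    + theta (alpha c) (br a b d) (A v).
Proof.
have := rep_theta_D hV a b c d v.
by rewrite -!addrA addrCA => /eqP; rewrite addrC subr_eq0 => /eqP <-; zmod.
Qed.

(** As [D c d] is a difference of two values of [theta], the Leibniz rule [repD_theta], used in both
    orders, passes to it. *)
Lemma repD_repD a b c d v :
  D (alpha a) (alpha b) (D c d v)
  = D (alpha c) (alpha d) (D a b v) + D (br a b c) (alpha d) (A v)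
    + D (alpha c) (br a b d) (A v).
Proof.
rewrite {2}/repD (linear_morphD (@repD_linear _ _)).
rewrite (linear_morphN (@repD_linear _ _)) !repD_theta.
set w := D a b v; rewrite /repD; zmod.
Qed.

(** The bracket part of [L_X], a twisted derivation: the bracket enters one slot while [alpha] acts
    on all others. The recursion stores the twisted prefix in [h]. *)
Fixpoint brsum x y h s : V :=
  if s is a :: s' then
    h (br x y a :: map alpha s') + brsum x y (fun t => h (alpha a :: t)) s'
  else 0.

(** The operator [L_X]. The bracket part twists its arguments, hence takes the next term [h] of the
    sequence, whereas [D] acts on values of [g]. *)
Definition Lie p x y g h s : V := D x^[p] y^[p] (g s) - brsum x y h s.

Definition theta_term p x y g s : V :=
  if s is [:: z] then
    theta y^[p] z^[p] (g [:: x]) - theta x^[p] z^[p] (g [:: y])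
  else 0.

(* The coboundary, up to a sign; g and h are the consecutive terms f_0 and f_1
   of a twisted sequence. *)
Fixpoint lcob p g h s : V :=
  if s is [:: x, y & s'] then
    Lie p x y g h s' + theta_term p x y g s'
    - lcob p (fun t => g [:: x, y & t])
        (fun t => h [:: alpha x, alpha y & t]) s'
  else 0.

(** * Linear dependence of the operators on the cochain *)

Lemma brsum_lin k x y h h1 h2 s :
  (forall t, size t = size s -> h t = k *: h1 t + h2 t) ->
  brsum x y h s = k *: brsum x y h1 s + brsum x y h2 s.
Proof.
elim: s h h1 h2 => [|a s IH] h h1 h2 H /=; first by rewrite scaler0 addr0.
rewrite H /= ?size_map //.
rewrite (IH _ (fun t => h1 (alpha a :: t)) (fun t => h2 (alpha a :: t))).
  zmod.
by move=> t st; rewrite H //= st.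
Qed.

Lemma Lie_lin k p x y g g1 g2 h h1 h2 s :
  (forall t, size t = size s -> g t = k *: g1 t + g2 t) ->
  (forall t, size t = size s -> h t = k *: h1 t + h2 t) ->
  Lie p x y g h s = k *: Lie p x y g1 h1 s + Lie p x y g2 h2 s.
Proof.
move=> Hg Hh; rewrite /Lie (brsum_lin _ _ Hh) Hg // repD_linear; zmod.
Qed.

Lemma theta_term_lin k p x y g g1 g2 s :
  (forall t, size t = size s -> g t = k *: g1 t + g2 t) ->
  theta_term p x y g s = k *: theta_term p x y g1 s + theta_term p x y g2 s.
Proof.
case: s => [|z []] Hg /=; rewrite ?scaler0 ?addr0 //.
rewrite !Hg // !theta_linear3; zmod.
Qed.

(** Assuming the relations only at the length that gets evaluated makes extensionality ([k = 0]) and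
    vanishing ([k = -1]) special cases. *)
Lemma lcob_lin k p g g1 g2 h h1 h2 s :
  (forall t, (size t).+2 = size s -> g t = k *: g1 t + g2 t) ->
  (forall t, (size t).+2 = size s -> h t = k *: h1 t + h2 t) ->
  lcob p g h s = k *: lcob p g1 h1 s + lcob p g2 h2 s.
Proof.
elim/pair_ind: s g g1 g2 h h1 h2 => [|a|x y s IH] g g1 g2 h h1 h2 Hg Hh /=;
  rewrite ?scaler0 ?addr0 //.
have Hg2 t : size t = size s -> g t = k *: g1 t + g2 t.
  by move=> st; rewrite Hg //= st.
have Hh2 t : size t = size s -> h t = k *: h1 t + h2 t.
  by move=> st; rewrite Hh //= st.
rewrite (Lie_lin p _ _ Hg2 Hh2) (theta_term_lin p x y Hg2).
rewrite (IH _ (fun t => g1 [:: x, y & t]) (fun t => g2 [:: x, y & t]) _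
  (fun t => h1 [:: alpha x, alpha y & t])
  (fun t => h2 [:: alpha x, alpha y & t])).
- zmod.
- by move=> t /= st; rewrite Hg //= st.
- by move=> t /= st; rewrite Hh //= st.
Qed.

Lemma brsum0 x y h s :
  (forall t, size t = size s -> h t = 0) -> brsum x y h s = 0.
Proof.
(* Where [h] vanishes, [h = - h + h], so the sum equals its opposite plus itself. *)
move=> H; rewrite (@brsum_lin (-1) _ _ h h h) ?scaleN1r ?addNr // => t /H ->.
by rewrite scaler0 addr0.
Qed.

Lemma lcob_ext p g g1 h h1 s :
  (forall t, (size t).+2 = size s -> g t = g1 t) ->
  (forall t, (size t).+2 = size s -> h t = h1 t) ->
  lcob p g h s = lcob p g1 h1 s.
Proof.
move=> Hg Hh; rewrite (@lcob_lin 0 _ g g g1 h h h1) ?scale0r ?add0r // => t.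
  by move=> /Hg ->; rewrite scale0r add0r.
by move=> /Hh ->; rewrite scale0r add0r.
Qed.

Lemma lcobD p g1 g2 h1 h2 s :
  lcob p (fun t => g1 t + g2 t) (fun t => h1 t + h2 t) s
  = lcob p g1 h1 s + lcob p g2 h2 s.
Proof.
rewrite (@lcob_lin 1 _ _ g1 g2 _ h1 h2) ?scale1r // => t _; by rewrite scale1r.
Qed.

Lemma lcobB p g1 g2 h1 h2 s :
  lcob p (fun t => g1 t - g2 t) (fun t => h1 t - h2 t) s
  = lcob p g1 h1 s - lcob p g2 h2 s.
Proof.
rewrite (@lcob_lin (-1) _ _ g2 g1 _ h2 h1) ?scaleN1r 1?addrC // => t _;
  by rewrite scaleN1r addrC.
Qed.

Lemma lcob0 p g h s :
  (forall t, (size t).+2 = size s -> g t = 0) ->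
  (forall t, (size t).+2 = size s -> h t = 0) -> lcob p g h s = 0.
Proof.
move=> Hg Hh; rewrite (@lcob_lin (-1) _ _ g g _ h h) ?scaleN1r ?addNr // => t.
  by move=> /Hg ->; rewrite scaler0 addr0.
by move=> /Hh ->; rewrite scaler0 addr0.
Qed.

Lemma brsumD x y h1 h2 s :
  brsum x y (fun t => h1 t + h2 t) s = brsum x y h1 s + brsum x y h2 s.
Proof.
by rewrite (@brsum_lin 1 _ _ _ h1 h2) ?scale1r // => t _; rewrite scale1r.
Qed.

Lemma brsumB x y h1 h2 s :
  brsum x y (fun t => h1 t - h2 t) s = brsum x y h1 s - brsum x y h2 s.
Proof.
rewrite (@brsum_lin (-1) _ _ _ h2 h1) ?scaleN1r 1?addrC // => t _;
  by rewrite scaleN1r addrC.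
Qed.

Lemma LieD p x y g1 g2 h1 h2 s :
  Lie p x y (fun t => g1 t + g2 t) (fun t => h1 t + h2 t) s
  = Lie p x y g1 h1 s + Lie p x y g2 h2 s.
Proof.
rewrite (@Lie_lin 1 _ _ _ _ g1 g2 _ h1 h2) ?scale1r // => t _;
  by rewrite scale1r.
Qed.

Lemma LieB p x y g1 g2 h1 h2 s :
  Lie p x y (fun t => g1 t - g2 t) (fun t => h1 t - h2 t) s
  = Lie p x y g1 h1 s - Lie p x y g2 h2 s.
Proof.
rewrite (@Lie_lin (-1) _ _ _ _ g2 g1 _ h2 h1) ?scaleN1r 1?addrC // => t _;
  by rewrite scaleN1r addrC.
Qed.

(** * Multilinear and equivariant functions of lists *)

Definition multilin g := forall s t k x y,
  g (s ++ (k *: x + y) :: t) = k *: g (s ++ x :: t) + g (s ++ y :: t).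

Lemma multilin_cons g a : multilin g -> multilin (fun t => g (a :: t)).
Proof. by move=> H s t k x y; rewrite -!cat_cons H. Qed.

Lemma multilin_cons2 g a b : multilin g -> multilin (fun t => g [:: a, b & t]).
Proof. by move=> H s t k x y; rewrite -!cat_cons H. Qed.

Lemma multilinD g s t x y : multilin g ->
  g (s ++ (x + y) :: t) = g (s ++ x :: t) + g (s ++ y :: t).
Proof. by move=> H; rewrite -[x]scale1r H !scale1r. Qed.

Lemma multilin0 g s t : multilin g -> g (s ++ 0 :: t) = 0.
Proof.
by move=> H; apply: (addrI (g (s ++ 0 :: t))); rewrite -multilinD // !addr0.
Qed.

Definition equivariant g h := forall s, A (g s) = h (map alpha s).

(** * Twisting by [alpha] and commutation relations *)

Lemma brsum_repD a b x y h s :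
  brsum x y (fun t => D a b (h t)) s = D a b (brsum x y h s).
Proof.
elim: s h => [|c s IH] h /=; first by rewrite (linear_map0 (@repD_linear a b)).
by rewrite (IH (fun t => h (alpha c :: t))) (linear_morphD (@repD_linear a b)).
Qed.

Lemma brsum_map x y h s :
  brsum x y (fun t => h (map alpha t)) s
  = brsum (alpha x) (alpha y) h (map alpha s).
Proof.
elim: s h => //= a s IH h.
by rewrite (IH (fun t => h (alpha (alpha a) :: t))) (br_multiplicative hT).
Qed.

Lemma Lie_map p x y g h s :
  Lie p.+1 x y (fun t => g (map alpha t)) (fun t => h (map alpha t)) s
  = Lie p (alpha x) (alpha y) g h (map alpha s).
Proof. by rewrite /Lie brsum_map !iterSr. Qed.

Lemma theta_term_map p x y g s :
  theta_term p.+1 x y (fun t => g (map alpha t)) s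
  = theta_term p (alpha x) (alpha y) g (map alpha s).
Proof. by case: s => [|z []] //; rewrite /theta_term /= -!iterSr. Qed.

(** Multiplicativity moves [alpha] through the brackets, and one of the [p.+1] twists in [theta] and
    [D] is absorbed by the arguments. *)
Lemma lcob_map p g h s :
  lcob p.+1 (fun t => g (map alpha t)) (fun t => h (map alpha t)) s
  = lcob p g h (map alpha s).
Proof.
elim/pair_ind: s g h => //= x y s IH g h.
by rewrite Lie_map theta_term_map -IH.
Qed.

Lemma brsum_comm x1 x2 y1 y2 h s : multilin h ->
  brsum x1 x2 (brsum (alpha y1) (alpha y2) h) s
  = brsum y1 y2 (brsum (alpha x1) (alpha x2) h) s
    - brsum (br x1 x2 y1) (alpha y2) h (map alpha s)
    - brsum (alpha y1) (br x1 x2 y2) h (map alpha s).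
Proof.
elim: s h => [|a s IH] h Hh /=; first by rewrite !subr0.
rewrite !brsumD.
rewrite (IH (fun t => h (alpha (alpha a) :: t))); last exact: multilin_cons.
(* Terms with brackets in two different slots agree on both sides by multiplicativity; where both
   brackets hit [a], the derivation axiom leaves the two terms of [[X,Y]]. *)
rewrite (brsum_map _ _ (fun t => h (br (alpha y1) (alpha y2) (alpha a) :: t))).
rewrite (brsum_map _ _ (fun t => h (br (alpha x1) (alpha x2) (alpha a) :: t))).
rewrite -!(br_multiplicative hT) (br_hom_derivation hT x1 x2).
rewrite !(@multilinD h [::]) //=; zmod.
Qed.

(** This is [[L_X, L_Y] = L_[X,Y]], with [[X,Y]] the sum of the pairs [(br x1 x2 y1, alpha y2)] and
    [(alpha y1, br x1 x2 y2)]: [repD_repD] on values, [brsum_comm] on arguments. *)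
Lemma Lie_comm p x1 x2 y1 y2 g0 g1 g2 s :
  equivariant g0 g1 -> multilin g2 ->
  Lie p.+1 x1 x2 (Lie p y1 y2 g0 g1) (Lie p (alpha y1) (alpha y2) g1 g2) s
  = Lie p.+1 y1 y2 (Lie p x1 x2 g0 g1) (Lie p (alpha x1) (alpha x2) g1 g2) s
    + Lie p (br x1 x2 y1) (alpha y2) g1 g2 (map alpha s)
    + Lie p (alpha y1) (br x1 x2 y2) g1 g2 (map alpha s).
Proof.
move=> E L; rewrite /Lie 2!brsumB brsum_comm // !brsum_repD.
rewrite ![D _ _ (D _ _ _ - _)]repDB.
rewrite repD_repD !iter_alpha_br E -!iterSr; zmod.
Qed.

(** This is [[L_X, t_Y] = t_[X,Y]], the Leibniz rule for [theta] when a single argument remains; at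
    other lengths everything vanishes. *)
Lemma Lie_theta_term p x1 x2 y1 y2 g0 g1 s :
  equivariant g0 g1 ->
  Lie p.+1 x1 x2 (theta_term p y1 y2 g0)
    (theta_term p (alpha y1) (alpha y2) g1) s
  = theta_term p.+1 y1 y2 (Lie p x1 x2 g0 g1) s
    + theta_term p (br x1 x2 y1) (alpha y2) g1 (map alpha s)
    + theta_term p (alpha y1) (br x1 x2 y2) g1 (map alpha s).
Proof.
move=> E; case: s => [|z [|z' s]].
- by rewrite /Lie /= (linear_map0 (@repD_linear _ _)) subr0 !addr0.
- rewrite /Lie /= addr0 repDB.
  rewrite !repD_theta !linearB !E !iter_alpha_br -!iterSr /= !addr0; zmod.
- rewrite /Lie brsum0; last by case=> [|a []].
  by rewrite (linear_map0 (@repD_linear _ _)) !addr0 subr0.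
Qed.

Lemma Lie_cons2 p x1 x2 y1 y2 g h s :
  Lie p x1 x2 g h [:: y1, y2 & s]
  = Lie p x1 x2 (fun t => g [:: y1, y2 & t])
      (fun t => h [:: alpha y1, alpha y2 & t]) s
    - h [:: br x1 x2 y1, alpha y2 & map alpha s]
    - h [:: alpha y1, br x1 x2 y2 & map alpha s].
Proof. rewrite /Lie /=; zmod. Qed.

(* When the first pair Y of s is split off, L_X i_Y and i_Y L_X differ by the
   insertion of [X, Y], which cancels against the bracket terms of [L_X, L_Y]. *)
Lemma Lie_lcob p x1 x2 g0 g1 g2 s :
  equivariant g0 g1 -> equivariant g1 g2 -> multilin g2 ->
  Lie p.+1 x1 x2 (lcob p g0 g1) (lcob p g1 g2) s
  = lcob p.+1 (Lie p x1 x2 g0 g1) (Lie p (alpha x1) (alpha x2) g1 g2) s.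
Proof.
elim/pair_ind: s g0 g1 g2 => [|a|y1 y2 s IH] g0 g1 g2 E0 E1 L2.
- by rewrite /Lie /= (linear_map0 (@repD_linear _ _)) subr0.
- by rewrite /Lie /= (linear_map0 (@repD_linear _ _)) addr0 subr0.
rewrite Lie_cons2 /=.
rewrite LieB LieD Lie_comm // Lie_theta_term // IH; first last.
- exact: multilin_cons2.
- by move=> t; rewrite E1.
- by move=> t; rewrite E0.
pose h1 := Lie p x1 x2 (fun t => g0 [:: y1, y2 & t])
  (fun t => g1 [:: alpha y1, alpha y2 & t]).
pose h2 := Lie p (alpha x1) (alpha x2) (fun t => g1 [:: alpha y1, alpha y2 & t])
  (fun t => g2 [:: alpha (alpha y1), alpha (alpha y2) & t]).
(* The correction terms depend only on the twisted list, so [lcob_map] brings them to exponent [p],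
   where they match the insertion of [[X,Y]]. *)
rewrite (@lcob_ext p.+1 (fun t => Lie p x1 x2 g0 g1 [:: y1, y2 & t])
  (fun t => h1 t - g1 [:: br x1 x2 y1, alpha y2 & map alpha t]
            - g1 [:: alpha y1, br x1 x2 y2 & map alpha t])
  (fun t => Lie p (alpha x1) (alpha x2) g1 g2 [:: alpha y1, alpha y2 & t])
  (fun t => h2 t - g2 [:: alpha (br x1 x2 y1), alpha (alpha y2) & map alpha t]
            - g2 [:: alpha (alpha y1), alpha (br x1 x2 y2) & map alpha t])).
- rewrite 2!lcobB.
  rewrite (lcob_map p (fun t => g1 [:: br x1 x2 y1, alpha y2 & t])
    (fun t => g2 [:: alpha (br x1 x2 y1), alpha (alpha y2) & t])).
  rewrite (lcob_map p (fun t => g1 [:: alpha y1, br x1 x2 y2 & t])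
    (fun t => g2 [:: alpha (alpha y1), alpha (br x1 x2 y2) & t])).
  rewrite /h1 /h2; zmod.
- by move=> t _; rewrite Lie_cons2.
- by move=> t _; rewrite Lie_cons2 -!(br_multiplicative hT).
Qed.

Lemma lcob_theta_term p x1 x2 g0 g1 s : equivariant g0 g1 ->
  lcob p.+1 (theta_term p x1 x2 g0)
    (theta_term p (alpha x1) (alpha x2) g1) s = 0.
Proof.
move=> E; case: s => [|y1 [|y2 s]] //=.
rewrite [lcob _ _ _ _]lcob0 // subr0.
case: s => [|z [|z' s]].
- by rewrite /Lie /= (linear_map0 (@repD_linear _ _)) subrr addr0.
(* One instance of the axiom for each of the two terms of [theta_term]; their difference is the
   goal. *)
- have := rep_theta_theta hV x2^[p] y1^[p] y2^[p] z^[p] (g0 [:: x1]).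
  have := rep_theta_theta hV x1^[p] y1^[p] y2^[p] z^[p] (g0 [:: x2]).
  rewrite !E -!iter_alpha_br /Lie /= !addr0 !linearB repDB -!iterSr /= => e2 e1.
  rewrite -[RHS](subrr 0) -{1}e1 -e2; zmod.
- rewrite /Lie brsum0; last by case=> [|a []].
  by rewrite (linear_map0 (@repD_linear _ _)) addr0 subr0.
Qed.

Lemma lcob_lcob p g0 g1 g2 s :
  equivariant g0 g1 -> equivariant g1 g2 -> multilin g2 ->
  lcob p.+1 (lcob p g0 g1) (lcob p g1 g2) s = 0.
Proof.
elim/pair_ind: s g0 g1 g2 => [|a|y1 y2 s IH] g0 g1 g2 E0 E1 L2 //=.
rewrite lcobB lcobD lcob_theta_term // Lie_lcob // IH; first last.
- exact: multilin_cons2.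
- by move=> t; rewrite E1.
- by move=> t; rewrite E0.
(* The term [t_Y] evaluates only at lists of length one, where [lcob] is 0. *)
have -> : theta_term p.+1 y1 y2 (lcob p g0 g1) s = 0.
  by case: s {IH} => [|z []] //=; rewrite !linear0 addr0.
zmod.
Qed.

(** * Equivariance and multilinearity of the coboundary *)

Lemma brsum_equivariant x y g h s : equivariant g h ->
  A (brsum x y g s) = brsum (alpha x) (alpha y) h (map alpha s).
Proof.
move=> E; elim: s g h E => [|a s IH] g h E /=; first by rewrite linear0.
rewrite linearD E /= (br_multiplicative hT); congr (_ + _).
by apply: IH => t; rewrite E.
Qed.

Lemma lcob_equivariant p g0 g1 g2 : equivariant g0 g1 -> equivariant g1 g2 ->
  equivariant (lcob p g0 g1) (lcob p g1 g2).
Proof.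
move=> E0 E1 s.
elim/pair_ind: s g0 g1 g2 E0 E1 => [|a|x y s IH] g0 g1 g2 E0 E1 /=;
  rewrite ?linear0 //.
rewrite linearB linearD; congr (_ + _ - _).
- rewrite /Lie linearB A_repD E0 (brsum_equivariant _ _ _ E1).
  by rewrite -!iterS !iterSr.
- case: s {IH} => [|z []] /=; rewrite ?linear0 //.
  by rewrite linearB -!(rep_equivariant hV) !E0 -!iterS !iterSr.
- by apply: IH => t /=; rewrite ?E0 ?E1.
Qed.

Lemma brsum_multilin x y h : multilin h -> multilin (brsum x y h).
Proof.
move=> L s; elim: s h L => [|c s IH] h L t k a b /=.
- rewrite (br_linear3 hT) (L [::]) /= linearP.
  rewrite (@brsum_lin k _ _ _ (fun t => h (alpha a :: t))
    (fun t => h (alpha b :: t))).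
    zmod.
  by move=> u _; exact: (L [::]).
- rewrite IH; last exact: multilin_cons.
  rewrite !map_cat /= linearP -!cat_cons L; zmod.
Qed.

Lemma brsum_lin1 k x x' y h s : multilin h ->
  brsum (k *: x + x') y h s = k *: brsum x y h s + brsum x' y h s.
Proof.
move=> L; elim: s h L => [|a s IH] h L /=; first by rewrite scaler0 addr0.
rewrite (br_linear1 hT) (L [::]) /= IH; last exact: multilin_cons.
zmod.
Qed.

Lemma brsum_lin2 k x y y' h s : multilin h ->
  brsum x (k *: y + y') h s = k *: brsum x y h s + brsum x y' h s.
Proof.
move=> L; elim: s h L => [|a s IH] h L /=; first by rewrite scaler0 addr0.
rewrite (br_linear2 hT) (L [::]) /= IH; last exact: multilin_cons.
zmod.
Qed.

Lemma theta_term0 p x y g s : size s != 1 -> theta_term p x y g s = 0.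
Proof. by case: s => [|z []]. Qed.

Lemma theta_term_lin1 k p x x' y g s : multilin g ->
  theta_term p (k *: x + x') y g s
  = k *: theta_term p x y g s + theta_term p x' y g s.
Proof.
move=> L; case: s => [|z []] /=; rewrite ?scaler0 ?addr0 //.
rewrite (L [::] [::]) iter_alpha_linear theta_linear1 theta_linear3 /=; zmod.
Qed.

Lemma theta_term_lin2 k p x y y' g s : multilin g ->
  theta_term p x (k *: y + y') g s
  = k *: theta_term p x y g s + theta_term p x y' g s.
Proof.
move=> L; case: s => [|z []] /=; rewrite ?scaler0 ?addr0 //.
rewrite (L [::] [::]) iter_alpha_linear theta_linear1 theta_linear3 /=; zmod.
Qed.

Lemma lcob_multilin p g h : multilin g -> multilin h -> multilin (lcob p g h).
Proof.
move=> Lg Lh s; elim/pair_ind: s g h Lg Lh => [|c|c d s IH] g h Lg Lh t k x y.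
- case: t => [|b t] /=; first by rewrite scaler0 addr0.
  rewrite (@lcob_lin k p _ (fun t => g [:: x, b & t]) (fun t => g [:: y, b & t])
    _ (fun t => h [:: alpha x, alpha b & t])
    (fun t => h [:: alpha y, alpha b & t])).
  + rewrite /Lie iter_alpha_linear repD_linear1 brsum_lin1 //.
    rewrite theta_term_lin1 //; zmod.
  + by move=> u _; exact: (Lg [::]).
  + by move=> u _; rewrite linearP; exact: (Lh [::]).
- rewrite /=.
  rewrite (@lcob_lin k p _ (fun t => g [:: c, x & t]) (fun t => g [:: c, y & t])
    _ (fun t => h [:: alpha c, alpha x & t])
    (fun t => h [:: alpha c, alpha y & t])).
  + rewrite /Lie iter_alpha_linear repD_linear2 brsum_lin2 //.
    rewrite theta_term_lin2 //; zmod.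
  + by move=> u _; exact: (Lg [:: c]).
  + by move=> u _; rewrite linearP; exact: (Lh [:: alpha c]).
- rewrite /= IH; [|exact: multilin_cons2..].
  rewrite /Lie Lg repD_linear brsum_multilin //.
  (* The varying argument enters [theta_term] only when it is the single one left after the first
     pair. *)
  case: s {IH} => [|e s]; first case: t => [|f t].
  + rewrite /= iter_alpha_linear !theta_linear2; zmod.
  + rewrite !theta_term0 //; zmod.
  + rewrite !theta_term0 ?size_cat ?addnS //; zmod.
Qed.

(** * Alternating and cyclic identities *)

Definition alt3 g := forall s x z, g (s ++ [:: x; x; z]) = 0.

Definition cyc3 g := forall s x y z,
  g (s ++ [:: x; y; z]) + g (s ++ [:: y; z; x]) + g (s ++ [:: z; x; y]) = 0.

(** Polarization of the alternating identity at [x + y]. *)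
Lemma alt3_antisym g s x y z : multilin g -> alt3 g ->
  g (s ++ [:: x; y; z]) = - g (s ++ [:: y; x; z]).
Proof.
move=> L N; apply/eqP; rewrite -addr_eq0; apply/eqP.
have := N s (x + y) z.
rewrite (multilinD s [:: x + y; z] x y L) -!(cat_rcons _ s [:: x + y; z]).
rewrite !(multilinD (rcons s _) [:: z] x y L) !cat_rcons !N.
by rewrite add0r addr0.
Qed.

(** A bracket hitting one of the two equal arguments makes them differ; the two such terms cancel by
    antisymmetry. *)
Lemma brsum_alt x y h : multilin h -> alt3 h -> alt3 (brsum x y h).
Proof.
move=> L N s; elim: s h L N => [|c s IH] h L N a z /=.
- by rewrite (alt3_antisym [::] _ _ _ L N) /= (N [::]) !addr0 addNr.
- rewrite IH; [|exact: multilin_cons|by move=> t u v; apply: (N (_ :: _))].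
  by rewrite map_cat /= -cat_cons N addr0.
Qed.

Lemma brsum_cyc x y h : cyc3 h -> cyc3 (brsum x y h).
Proof.
move=> C s; elim: s h C => [|c s IH] h C a b z /=.
- have C' := C [::]; rewrite /= in C'.
  (* The nine terms regroup into three cyclic identities, one for each argument hit by the
     bracket. *)
  have := C' (br x y a) (alpha b) (alpha z).
  have := C' (alpha a) (br x y b) (alpha z).
  have := C' (alpha a) (alpha b) (br x y z).
  move=> e3 e2 e1; rewrite !addr0.
  have := congr2 +%R (congr2 +%R e1 e2) e3; rewrite !addr0 => <-; zmod.
- have e1 := IH (fun t => h (alpha c :: t))
    (fun t u v w => C (alpha c :: t) u v w) a b z.
  have e2 := C (br x y c :: map alpha s) (alpha a) (alpha b) (alpha z).
  by have := congr2 +%R e1 e2; rewrite addr0 !map_cat => <- /=; zmod.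
Qed.

Lemma repD_alt a v : D a a v = 0.
Proof. exact: subrr. Qed.

(** An even prefix makes [(x, x)] one of the pairs split off, with [z] left alone: then [D x x] and
    [br x x z] vanish and the two terms of [theta_term] cancel. *)
Lemma lcob_alt p g h s x z :
  multilin h -> alt3 g -> alt3 h -> ~~ odd (size s) ->
  lcob p g h (s ++ [:: x; x; z]) = 0.
Proof.
elim/pair_ind: s g h => [|a|a b s IH] g h Lh Ng Nh //=.
- move=> _; rewrite /Lie /= repD_alt (br_alt hT) (multilin0 [::] [::] Lh).
  zmod.
- rewrite negbK => os.
  rewrite IH //; first last.
  + by move=> t u v; apply: (Nh (_ :: _ :: _)).
  + by move=> t u v; apply: (Ng (_ :: _ :: _)).
  + exact: multilin_cons2.
  rewrite /Lie Ng brsum_alt // theta_term0 ?size_cat ?addnS //.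
  by rewrite (linear_map0 (@repD_linear _ _)) !subr0 addr0.
Qed.

Lemma lcob_cyc p g h s x y z :
  multilin h -> cyc3 g -> cyc3 h -> ~~ odd (size s) ->
  lcob p g h (s ++ [:: x; y; z]) + lcob p g h (s ++ [:: y; z; x])
  + lcob p g h (s ++ [:: z; x; y]) = 0.
Proof.
elim/pair_ind: s g h => [|a|a b s IH] g h Lh Cg Ch //=.
- move=> _; rewrite /Lie /=.
  have e : h [:: br x y z] + h [:: br y z x] + h [:: br z x y] = 0.
    rewrite -!(multilinD [::] [::] _ _ Lh) (br_cyclic hT).
    exact: (multilin0 [::] [::] Lh).
  (* The bracket terms are cancelled by [e]; once [D] is unfolded, its [theta] terms cancel those of
     [theta_term]. *)
  rewrite !addr0 !subr0 -[RHS]oppr0 -e /repD; zmod.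
- rewrite negbK => os.
  have e1 := IH (fun t => g [:: a, b & t])
    (fun t => h [:: alpha a, alpha b & t]) (multilin_cons2 _ _ Lh)
    (fun t u v w => Cg [:: a, b & t] u v w)
    (fun t u v w => Ch [:: alpha a, alpha b & t] u v w) os.
  have e2 := brsum_cyc a b Ch s x y z.
  have e3 := congr1 (D a^[p] b^[p]) (Cg s x y z).
  rewrite !(linear_morphD (@repD_linear _ _)) in e3.
  rewrite (linear_map0 (@repD_linear _ _)) in e3.
  rewrite !theta_term0 ?size_cat ?addnS // /Lie !addr0.
  have := congr2 +%R (congr2 +%R e3 (congr1 -%R e2)) (congr1 -%R e1).
  by rewrite oppr0 !addr0 => <-; zmod.
Qed.

End ListCochains.

(** * From the explicit double sums to Cartan's recursion *)

Section Bridge.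

Variables (F : fieldType) (T V : lmodType F).
Variables (br : T -> T -> T -> T) (alpha : {linear T -> T}).
Variable theta : T -> T -> {linear V -> V}.

Local Notation D := (repD theta).
Local Notation lcob := (lcob br alpha theta).

(** Common form of both parities: odd degree has [g = h] and [p = n.-1]; even degree has [p = n],
    with [y] inserted in [g] and [alpha y] in [h]. *)
Definition cob_formula p n (g h : seq T -> V) (x : nat -> T) : V :=
  let a i := iter p alpha (x i) in
    theta (a n.*2) (a n.*2.+1) (g [seq x i | i <- iota 1 n.*2.-1])
  - theta (a n.*2.-1) (a n.*2.+1)
      (g [seq x i | i <- rcons (iota 1 n.*2.-2) n.*2])
  + \sum_(1 <= k < n.+1) (-1) ^+ (n + k) *:
      D (a k.*2.-1) (a k.*2) (g [seq x i | i <- hat_indices n k])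
  + \sum_(1 <= k < n.+1) \sum_(k.*2.+1 <= j < n.*2.+2) (-1) ^+ (n + k + 1) *:
      h [seq (if i == j then br (x k.*2.-1) (x k.*2) (x j)
              else alpha (x i)) | i <- hat_indices n k].

Lemma hat_indices1 n : hat_indices n.+1 1 = iota 3 n.*2.+1.
Proof.
transitivity [seq i <- iota 3 n.*2.+1 | i \notin [:: 1; 2]]%N.
  by rewrite /hat_indices doubleS.
by apply/all_filterP/allP => i; rewrite mem_iota !inE; case: i => [|[|[]]].
Qed.

Lemma hat_indicesS n k : (0 < k)%N ->
  hat_indices n.+1 k.+1 = [:: 1, 2 & [seq i.+2 | i <- hat_indices n k]]%N.
Proof.
case: k => // k _.
transitivity [:: 1, 2 & [seq i <- map (addn 2) (iota 1 n.*2.+1)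
    | i \notin [:: k.+2.*2.-1; k.+2.*2]]]%N; last by rewrite filter_map.
by rewrite -iotaDl /hat_indices (doubleS n).
Qed.

Lemma brsum_iota u v (h : seq T -> V) (x : nat -> T) c d :
  brsum br alpha u v h [seq x i | i <- iota c d]
  = \sum_(c <= j < c + d)
      h [seq (if i == j then br u v (x j) else alpha (x i)) | i <- iota c d].
Proof.
elim: d c h => [|d IH] c h; first by rewrite addn0 big_geq.
rewrite big_ltn; last by rewrite addnS ltnS leq_addr.
rewrite [LHS]/= [in RHS]/= eqxx; congr (h (_ :: _) + _).
  rewrite -map_comp; apply/eq_in_map => i; rewrite mem_iota => /andP [ci _] /=.
  by rewrite gtn_eqF.
rewrite IH addSnnS; apply: eq_big_nat => j /andP [cj _].
by rewrite ltn_eqF.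
Qed.

(** The summands with [k = 1] give [Lie] for the first pair; the others, with [k] lowered by one,
    give the formula for the remaining arguments. The sign arises because the formula counts signs
    from the last pair and the recursion from the first. *)
Lemma cob_formulaE p n g h (x : nat -> T) :
  cob_formula p n.+1 g h x
  = (-1) ^+ n *: lcob p g h [seq x i | i <- iota 1 n.+1.*2.+1].
Proof.
elim: n g h x => [|n IH] g h x.
  rewrite /cob_formula !big_nat1 hat_indices1 -(signr_odd _ (1 + 1)).
  rewrite -(signr_odd _ (1 + 1 + 1)) /= expr0 !scale1r expr1 scaleN1r /Lie /=.
  rewrite !addr0; zmod.
have {}IH := IH (fun t => g [:: x 1, x 2 & t]%N)
  (fun t => h [:: alpha (x 1), alpha (x 2) & t]%N) (fun i => x i.+2).
have -> : [seq x i | i <- iota 1 n.+2.*2.+1]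
    = [:: x 1%N, x 2%N & [seq x i.+2 | i <- iota 1 n.+1.*2.+1]].
  rewrite doubleS -[iota 1 _]/[:: 1, 2 & iota (2 + 1) n.+1.*2.+1]%N iotaDl.
  by rewrite /= -map_comp.
pose x' i := x i.+2.
pose g' t := g [:: x 1, x 2 & t]%N.
pose h' t := h [:: alpha (x 1%N), alpha (x 2%N) & t].
have shift m : [seq x i | i <- iota 3 m] = [seq x' i | i <- iota 1 m].
  by rewrite -[3%N]/(2 + 1)%N iotaDl -map_comp.
pose s := [seq x' i | i <- iota 1 n.+1.*2.+1].
have lcobE : lcob p g h [:: x 1%N, x 2%N & s]
    = Lie br alpha theta p (x 1%N) (x 2%N) g h s - lcob p g' h' s.
  (* The list [s] has at least three entries, so its [theta_term] computes to 0. *)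
  by rewrite -[Lie _ _ _ _ _ _ _ _ _]addr0.
have sgn m k : (-1) ^+ (m.+1 + k.+1) = (-1) ^+ (m + k) :> F.
  by rewrite addSn addnS 2!exprS mulrA mulN1r opprK mul1r.
have th1 : [seq x i | i <- iota 1 n.+2.*2.-1]
    = [:: x 1%N, x 2%N & [seq x' i | i <- iota 1 n.+1.*2.-1]].
  by rewrite -shift.
have th2 : [seq x i | i <- rcons (iota 1 n.+2.*2.-2) n.+2.*2]
    = [:: x 1%N, x 2%N & [seq x' i | i <- rcons (iota 1 n.+1.*2.-2) n.+1.*2]].
  by rewrite !map_rcons -shift.
have sum1 : \sum_(1 <= k < n.+3) (-1) ^+ (n.+2 + k) *:
      D (iter p alpha (x k.*2.-1)) (iter p alpha (x k.*2))
        (g [seq x i | i <- hat_indices n.+2 k])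
    = (-1) ^+ n.+1 *: D (iter p alpha (x 1%N)) (iter p alpha (x 2%N)) (g s)
      + \sum_(1 <= k < n.+2) (-1) ^+ (n.+1 + k) *:
      D (iter p alpha (x' k.*2.-1)) (iter p alpha (x' k.*2))
        (g' [seq x' i | i <- hat_indices n.+1 k]).
  rewrite big_ltn // big_add1 hat_indices1 shift sgn addn0; congr (_ + _).
  apply: eq_big_nat => -[//|k] _.
  by rewrite sgn hat_indicesS //= -map_comp.
have sum2 : \sum_(1 <= k < n.+3) \sum_(k.*2.+1 <= j < n.+2.*2.+2)
      (-1) ^+ (n.+2 + k + 1) *:
      h [seq (if i == j then br (x k.*2.-1) (x k.*2) (x j)
              else alpha (x i)) | i <- hat_indices n.+2 k]
    = - ((-1) ^+ n.+1 *: brsum br alpha (x 1%N) (x 2%N) h s)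
      + \sum_(1 <= k < n.+2) \sum_(k.*2.+1 <= j < n.+1.*2.+2)
      (-1) ^+ (n.+1 + k + 1) *:
      h' [seq (if i == j then br (x' k.*2.-1) (x' k.*2) (x' j)
              else alpha (x' i)) | i <- hat_indices n.+1 k].
  rewrite big_ltn // big_add1; congr (_ + _).
    rewrite /s -shift brsum_iota -scaler_sumr hat_indices1 !addn1.
    by rewrite !exprS !mulN1r !opprK scaleNr opprK.
  apply: eq_big_nat => -[//|k] _.
  (* Lowering [k] by one lowers the range of [j] by two. *)
  rewrite big_add1 big_add1; apply: eq_big_nat => -[//|j] _.
  rewrite !addn1 (exprS _ (n.+2 + _)) (exprS _ (n.+1 + _)) sgn.
  rewrite hat_indicesS //= -map_comp.
  by congr (_ *: h (_ :: _ :: _)).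
have e : (-1) ^+ n.+1 *: lcob p g' h' s = - cob_formula p n.+1 g' h' x'.
  by rewrite IH exprS mulN1r scaleNr.
rewrite -[[seq _ | i <- _]]/s lcobE scalerBr e /Lie /cob_formula.
rewrite th1 th2 sum1 sum2; zmod.
Qed.

End Bridge.

(** * From functions of lists to cochains on finite functions *)

Section Cochains.

Variables (F : fieldType) (T V : lmodType F).
Variables (br : T -> T -> T -> T) (alpha : {linear T -> T}).
Variables (A : {linear V -> V}) (theta : T -> T -> {linear V -> V}).
Hypotheses (hT : hom_LTS br alpha) (hV : hom_LTS_rep br alpha A theta).

Local Notation lcob := (lcob br alpha theta).

(* Vanishing on lists of the wrong length makes the cochain identities hold for
   all lists. *)
Definition extend m (f : {ffun 'I_m -> T} -> V) (s : seq T) : V :=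
  if size s == m then app_seq f s else 0.

Lemma extendE m (f : {ffun 'I_m -> T} -> V) s :
  size s = m -> extend f s = app_seq f s.
Proof. by rewrite /extend => ->; rewrite eqxx. Qed.

(** The exponent is [m./2] in both parities: n - 1 for m = 2n - 1, and n for m = 2n. *)
Definition cob_seq m (g : seq T -> V) (s : seq T) : V :=
  if odd m then lcob m./2 g g s
  else if s is y :: t then
    lcob m./2 (fun t => g (y :: t)) (fun t => g (alpha y :: t)) t
  else 0.

Lemma fgraph_nth m (s : seq T) :
  size s = m -> fgraph [ffun i : 'I_m => nth 0 s i] = s :> seq T.
Proof.
move=> sm; have st (t : #|'I_m|.-tuple T) : size t = m.
  by rewrite size_tuple card_ord.
apply: (@eq_from_nth _ 0) => [|i]; rewrite st // => im.
by rewrite -[i]/(nat_of_ord (Ordinal im)) nth_fgraph_ord ffunE.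
Qed.

Lemma app_seq_fgraph m (f : {ffun 'I_m -> T} -> V) x :
  app_seq f (fgraph x) = f x.
Proof. by congr f; apply/ffunP => i; rewrite ffunE nth_fgraph_ord. Qed.

(** For m = 2n + 1 or m = 2n + 2 the formula has n + 1 pairs, so [cob_formulaE] contributes the sign
    with exponent n = [m.-1./2]. *)
Lemma app_seq_coboundary m (f : {ffun 'I_m -> T} -> V) s :
  (0 < m)%N -> size s = m.+2 ->
  app_seq (coboundary br alpha theta f) s
  = (-1) ^+ m.-1./2 *: cob_seq m (extend f) s.
Proof.
move=> m0 sm; rewrite /app_seq /coboundary fgraph_nth // /cob_seq.
case: ifP => om.
- have [n mE] : exists n, m = n.*2.+1.
    by exists m./2; rewrite -[LHS]odd_double_half om.
  transitivity (cob_formula br alpha theta n n.+1 (app_seq f) (app_seq f)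
                 (fun i => nth 0 s i.-1)).
    by rewrite (_ : m.+1./2 = n.+1) // mE -doubleS doubleK.
  have -> : m.-1./2 = n by rewrite mE doubleK.
  have -> : m./2 = n by rewrite mE /= uphalf_double.
  rewrite cob_formulaE; congr (_ *: _).
  have -> : [seq nth 0 s i.-1 | i <- iota 1 n.+1.*2.+1] = s.
    rewrite -[1%N]/(1 + 0)%N iotaDl -map_comp.
    have <- : size s = n.+1.*2.+1 by rewrite sm mE.
    exact: (mkseq_nth 0 s).
  by apply: lcob_ext => t; rewrite sm => -[st]; rewrite extendE.
- have [n mE] : exists n, m = n.+1.*2.
    exists (m./2.-1); rewrite prednK; first by rewrite -[LHS]odd_double_half om.
    by rewrite half_gt0; case: (m) m0 om => [|[]].
  case: s sm => // y s [sm].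
  transitivity (cob_formula br alpha theta n.+1 n.+1
                 (fun t => app_seq f (y :: t))
                 (fun t => app_seq f (alpha y :: t)) (nth 0 (y :: s))).
    by rewrite (_ : m./2 = n.+1) // mE doubleK.
  have -> : m.-1./2 = n by rewrite mE doubleS /= uphalf_double.
  have -> : m./2 = n.+1 by rewrite mE doubleK.
  rewrite cob_formulaE; congr (_ *: _).
  have -> : [seq nth 0 (y :: s) i | i <- iota 1 n.+1.*2.+1] = s.
    rewrite -[1%N]/(1 + 0)%N iotaDl -map_comp.
    have <- : size s = n.+1.*2.+1 by rewrite sm mE.
    exact: (mkseq_nth 0 s).
  by apply: lcob_ext => t; rewrite sm => -[st]; rewrite extendE //= st.
Qed.

Section CobSeq.

Variables (m : nat) (g : seq T -> V).
Hypotheses (Lg : multilin g) (Eg : equivariant alpha A g g).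

Let Eg1 y :
  equivariant alpha A (fun t => g (y :: t)) (fun t => g (alpha y :: t)).
Proof. by move=> t; rewrite Eg. Qed.

Lemma cob_seq_multilin : multilin (cob_seq m g).
Proof.
move=> s t k x y; rewrite /cob_seq; case: ifP => _.
  exact: (lcob_multilin hT hV).
case: s => [|c s].
- rewrite /= (@lcob_lin _ _ _ _ _ _ k _ _
    (fun t => g (x :: t)) (fun t => g (y :: t))
    _ (fun t => g (alpha x :: t)) (fun t => g (alpha y :: t))) // => u _.
    exact: (Lg [::]).
  by rewrite linearP; exact: (Lg [::]).
- by apply: (lcob_multilin hT hV); apply: multilin_cons.
Qed.

Lemma cob_seq_equivariant : equivariant alpha A (cob_seq m g) (cob_seq m g).
Proof.
move=> s; rewrite /cob_seq; case: ifP => _.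
  exact: (lcob_equivariant hT hV).
by case: s => [|y s]; [exact: linear0|exact: (lcob_equivariant hT hV)].
Qed.

(** The parity condition leaves an even prefix for [lcob_alt], once [y] is removed when [m] is
    even. *)
Lemma cob_seq_alt s x z : alt3 g -> odd (size s) != odd m ->
  cob_seq m g (s ++ [:: x; x; z]) = 0.
Proof.
move=> N; rewrite /cob_seq; case: ifP => _.
  by rewrite eqb_id => os; apply: (lcob_alt theta hT).
case: s => //= y s; rewrite eqbF_neg negbK => os.
apply: (lcob_alt theta hT) => //.
- exact: multilin_cons.
- by move=> t u v; apply: (N (_ :: _)).
- by move=> t u v; apply: (N (_ :: _)).
Qed.

Lemma cob_seq_cyc s x y z : cyc3 g -> odd (size s) != odd m ->
  cob_seq m g (s ++ [:: x; y; z]) + cob_seq m g (s ++ [:: y; z; x])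
  + cob_seq m g (s ++ [:: z; x; y]) = 0.
Proof.
move=> C; rewrite /cob_seq; case: ifP => _.
  by rewrite eqb_id => os; apply: (lcob_cyc theta hT).
case: s => //= c s; rewrite eqbF_neg negbK => os.
apply: (lcob_cyc theta hT) => //.
- exact: multilin_cons.
- by move=> t u v w; apply: (C (_ :: _)).
- by move=> t u v w; apply: (C (_ :: _)).
Qed.

(** To be used with [g'] the extension by 0 of a coboundary, which agrees with [cob_seq] up to the
    sign [c] only at the right length. *)
Lemma cob_seq_cob_seq g' c s : (0 < m)%N ->
  (forall t, (size t).+2 = size s -> g' t = c *: cob_seq m g t) ->
  cob_seq m.+2 g' s = 0.
Proof.
move=> m0 H; rewrite /cob_seq /= negbK.
have {}H t : (size t).+2 = size s -> g' t = c *: cob_seq m g t + 0.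
  by move/H ->; rewrite addr0.
case: ifP => om.
- rewrite (@lcob_lin _ _ _ _ _ _ c _ _ (lcob m./2 g g) (fun=> 0)
    _ (lcob m./2 g g) (fun=> 0));
    try by move=> t /H; rewrite /cob_seq om.
  by rewrite (lcob_lcob hT hV) // lcob0 // scaler0 addr0.
case: s H => // y s H.
(* Inserting [y], [alpha y] and [alpha (alpha y)] gives the three consecutive terms of the twisted
   sequence required by [lcob_lcob]. *)
rewrite (@lcob_lin _ _ _ _ _ _ c _ _
  (lcob m./2 (fun t => g (y :: t)) (fun t => g (alpha y :: t))) (fun=> 0) _
  (lcob m./2 (fun t => g (alpha y :: t)) (fun t => g (alpha (alpha y) :: t)))
  (fun=> 0)).
- rewrite (lcob_lcob hT hV) ?lcob0 ?scaler0 ?addr0 //; exact: multilin_cons.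
- by move=> t st; rewrite H /= ?st // /cob_seq om.
- by move=> t st; rewrite H /= ?st // /cob_seq om.
Qed.

End CobSeq.

(** * The coboundary of a cochain and its square *)

Section Main.

Variables (n : nat) (f : {ffun 'I_n -> T} -> V).
Hypotheses (n0 : (0 < n)%N) (hf : hom_cochain alpha A f).

Lemma nth_set_at (s t : seq T) u v i :
  nth 0 (s ++ u :: t) i = if i == size s then u else nth 0 (s ++ v :: t) i.
Proof.
rewrite !nth_cat; case: ltngtP => // [si|->]; last by rewrite subnn.
by case: (i - size s)%N (subn_gt0 (size s) i) => //=; rewrite si.
Qed.

Lemma extend_multilin : multilin (extend f).
Proof.
move=> s t k x y; rewrite /extend !size_cat /=.
case: eqP => sn; last by rewrite scaler0 addr0.
have sin : (size s < n)%N by rewrite -sn addnS ltnS leq_addr.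
have E u : app_seq f (s ++ u :: t)
    = f [ffun j => if j == Ordinal sin then u
                   else [ffun j : 'I_n => nth 0 (s ++ 0 :: t) j] j].
  by congr f; apply/ffunP => j; rewrite !ffunE (nth_set_at s t u 0).
by rewrite !E (cochain_multilinear hf).
Qed.

Lemma extend_equivariant : equivariant alpha A (extend f) (extend f).
Proof.
move=> s; rewrite /extend size_map; case: eqP => sn; last exact: linear0.
rewrite /app_seq (cochain_equivariant hf); congr f; apply/ffunP => i.
by rewrite !ffunE (nth_map 0) // sn.
Qed.

Lemma extend_alt : alt3 (extend f).
Proof.
move=> s x z; rewrite /extend size_cat; case: eqP => // sn.
by apply: (cochain_alt hf); rewrite -sn addnC.
Qed.

Lemma extend_cyc : cyc3 (extend f).
Proof.
move=> s x y z; rewrite /extend !size_cat /=.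
case: eqP => sn; last by rewrite !addr0.
by apply: (cochain_cyclic hf); rewrite -sn addnC.
Qed.

Local Notation cob := (coboundary br alpha theta f).

Lemma coboundary_cob_seq x :
  cob x = (-1) ^+ n.-1./2 *: cob_seq n (extend f) (fgraph x).
Proof.
rewrite -app_seq_fgraph app_seq_coboundary //.
by rewrite size_tuple card_ord.
Qed.

Lemma coboundary_cochain : hom_cochain alpha A cob.
Proof.
have sE (s : seq T) : (size s).+3 = n.+2 -> odd (size s) != odd n.
  by case=> <- /=; case: odd.
split.
- move=> x i k u v; rewrite !coboundary_cob_seq.
  (* Changing the value at [i] amounts to replacing one entry of the graph, which is the form used
     by [multilin]. *)
  have E w : fgraph [ffun j => if j == i then w else x j]
      = take i (fgraph x) ++ w :: drop i.+1 (fgraph x) :> seq T.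
    have sx : size (fgraph x) = n.+2 by rewrite size_tuple card_ord.
    have szt : size (take i (fgraph x)) = i by rewrite size_takel // sx ltnW.
    rewrite -[RHS](@fgraph_nth n.+2); last first.
      by rewrite size_cat szt /= size_drop sx subnSK // addnBA ?addKn // ltnW.
    congr (tval (fgraph _)); apply/ffunP => j; rewrite !ffunE.
    rewrite (nth_set_at _ _ w (nth 0 (fgraph x) i)) szt.
    by rewrite -drop_nth ?sx // cat_take_drop nth_fgraph_ord.
  by rewrite !E (cob_seq_multilin _ extend_multilin) scalerDr !scalerA mulrC.
- move=> x; rewrite !coboundary_cob_seq linearZ_LR.
  rewrite (cob_seq_equivariant _ extend_equivariant).
  congr (_ *: cob_seq _ _ _); apply: (@eq_from_nth _ 0).
    by rewrite size_map !size_tuple.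
  have sx (t : #|'I_n.+2|.-tuple T) : size t = n.+2.
    by rewrite size_tuple card_ord.
  move=> i; rewrite size_map sx => im; rewrite (nth_map 0) ?sx //.
  by rewrite -[i]/(nat_of_ord (Ordinal im)) !nth_fgraph_ord ffunE.
- move=> s x z sn; rewrite app_seq_coboundary ?size_cat ?addn3 //.
  rewrite cob_seq_alt ?scaler0 ?sE //; first exact: extend_multilin.
  exact: extend_alt.
- move=> s x y z sn; rewrite !app_seq_coboundary ?size_cat ?addn3 //.
  rewrite -!scalerDr cob_seq_cyc ?scaler0 ?sE //; first exact: extend_multilin.
  exact: extend_cyc.
Qed.

Lemma coboundary_coboundary x : coboundary br alpha theta cob x = 0.
Proof.
rewrite -app_seq_fgraph app_seq_coboundary //; last first.
  by rewrite size_tuple card_ord.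
rewrite (cob_seq_cob_seq (m := n) extend_multilin extend_equivariant
  (c := (-1) ^+ n.-1./2)) ?scaler0 //.
move=> t; rewrite size_tuple card_ord => -[st].
by rewrite extendE // app_seq_coboundary.
Qed.

End Main.

End Cochains.

Theorem theorem2p8 (F : fieldType) (T V : lmodType F)
    (br : T -> T -> T -> T) (alpha : {linear T -> T})
    (A : {linear V -> V}) (theta : T -> T -> {linear V -> V})
    (hT : hom_LTS br alpha) (hV : hom_LTS_rep br alpha A theta)
    (n : nat) (hn : (1 <= n)%N) :
  (forall f : {ffun 'I_n -> T} -> V, hom_cochain alpha A f ->
     hom_cochain alpha A (coboundary br alpha theta f)) /\
  (forall f : {ffun 'I_n -> T} -> V, hom_cochain alpha A f ->
     forall x : {ffun 'I_n.+4 -> T},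
       coboundary br alpha theta (coboundary br alpha theta f) x = 0).
Proof.
split=> f hf; first exact: (coboundary_cochain hT hV hn hf).
exact: (coboundary_coboundary hT hV hn hf).
Qed.
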